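(* (a) For $n=5$ and for every $n\ge 7$, $\sigma(K_{3,1,1},n)=4n-2$; equivalently, $4n-2$ is the least even integer such that every $n$-term graphical sequence $S$ with $\sigma(S)\ge 4n-2$ is potentially $K_{3,1,1}$-graphic. (b) For $n=6$: if $S$ is a $6$-term graphical sequence with $\sigma(S)\ge 22$, then either $S$ is potentially $K_{3,1,1}$-graphic or $S=(4,4,4,4,4,4)$; moreover $(4,4,4,4,4,4)$ is not potentially $K_{3,1,1}$-graphic, and consequently $\sigma(K_{3,1,1},6)=26$.
   Context: A finite sequence $S=(d_1,\dots,d_n)$ of non-negative integers is graphical if it is the degree sequence of some simple graph on $n$ vertices (a realization of $S$). Write $\sigma(S)=d_1+\dots+d_n$. For a graph $H$, a graphical sequence $S$ is potentially $H$-graphical if some realization of $S$ contains $H$ as a subgraph. $K_{3,1,1}$ denotes the complete 3-partite graph with parts of sizes $3,1,1$. $\sigma(H,n)$ denotes the minimum even integer $l$ such that every $n$-term graphical sequence $S$ with $\sigma(S)\ge l$ is potentially $H$-graphical. *)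

(* Defs.v *)
From mathcomp Require Import all_boot.
Set Implicit Arguments. Unset Strict Implicit. Unset Printing Implicit Defensive.

Definition realizes (n : nat) (e : rel 'I_n) (s : seq nat) : Prop :=
  [/\ symmetric e, irreflexive e, size s = n &
      forall i : 'I_n, #|[set j | e i j]| = nth 0 s i].

Definition graphical (n : nat) (s : seq nat) : Prop :=
  exists e : rel 'I_n, realizes e s.

Definition contains_subgraph (V W : finType) (h : rel V) (e : rel W) : Prop :=
  exists f : V -> W, injective f /\ forall u v, h u v -> e (f u) (f v).

Definition potentially (V : finType) (h : rel V) (n : nat) (s : seq nat) : Prop :=
  exists e : rel 'I_n, realizes e s /\ contains_subgraph h e.

Definition sigma_seq (s : seq nat) : nat := sumn s.

Definition sigma_bound (V : finType) (h : rel V) (n l : nat) : Prop :=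
  forall s : seq nat, size s = n -> graphical n s -> l <= sigma_seq s ->
    potentially h n s.

Definition is_sigma (V : finType) (h : rel V) (n l : nat) : Prop :=
  [/\ ~~ odd l, sigma_bound h n l &
      forall l', ~~ odd l' -> sigma_bound h n l' -> l <= l'].

Definition part311 (u : 'I_5) : nat :=
  if (u : nat) < 3 then 0 else if (u : nat) == 3 then 1 else 2.

Definition K311 : rel 'I_5 := fun u v => part311 u != part311 v.

(* Main.v *)
Require Import Defs.
From mathcomp Require Import all_boot.
From mathcomp Require Import zify.
Set Implicit Arguments. Unset Strict Implicit. Unset Printing Implicit Defensive.

(* The wheel, with degree sequence (n-1, 3, ..., 3), has a single vertex of
   degree at least 4 while K_{3,1,1} has two, so 4n - 4 does not suffice.

   For the upper bound, let G have k vertices and degree sum at least 4k - 3,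
   and argue by induction on k.  Let x be a vertex of minimum degree d.
   - If the degree sum of G - x is still at least 4(k - 1) - 3, apply the
     induction hypothesis to G - x and put x back.
   - Otherwise d = 3 and the sum is at most 4k - 2, or G is 4-regular.  For
     d = 3, an edge switch makes two neighbours p, q of x nonadjacent.  Delete
     x, add the edge pq, and apply the induction hypothesis; the sum has dropped
     by exactly 4.  In the new realization some edge ab, disjoint from the third
     neighbour r of x, can be removed without destroying every copy of K_{3,1,1};
     join x to a, b and r.
   - A 4-regular realization for k >= 7 comes from the join of 3K_1 and 2K_2 by
     repeatedly joining a new vertex to the ends of two removed disjoint edges.
   The exceptional octahedron reappears only when G - x is an octahedron, where
   one more switch produces K_{3,1,1}. *)

(** * Simple graphs on a fixed vertex type: degrees and elementary edits *)

Definition simple (T : finType) (e : rel T) : Prop := symmetric e /\ irreflexive e.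

(** A sum of 0/1 values, so that the effect of an edit on a degree is computed term by term. *)
Definition deg (T : finType) (e : rel T) (x : T) : nat := \sum_y e x y.

Definition add_edge (T : finType) (e : rel T) (p q : T) : rel T :=
  fun x y => [|| e x y, (x == p) && (y == q) | (x == q) && (y == p)].

Definition del_edge (T : finType) (e : rel T) (p q : T) : rel T :=
  fun x y => [&& e x y, ~~ ((x == p) && (y == q)) & ~~ ((x == q) && (y == p))].

(** [x] stays in [T] as an isolated vertex; the vertices still in play are recorded by a set. *)
Definition del_vertex (T : finType) (e : rel T) (x : T) : rel T :=
  fun y z => [&& e y z, y != x & z != x].

Definition add_vertex (T : finType) (e : rel T) (x : T) (N : pred T) : rel T :=
  fun y z => [|| e y z, (y == x) && N z | (z == x) && N y].

Lemma degE (T : finType) (e : rel T) x : deg e x = #|[set y | e x y]|.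
Proof.
rewrite /deg -sum1dep_card [RHS]big_mkcond /=.
by apply: eq_bigr => y _; case: (e x y).
Qed.

Lemma sum_pred1 (T : finType) (b : bool) (q : T) : \sum_y (b && (y == q) : nat) = b.
Proof.
rewrite (bigD1 q) //= eqxx andbT big1 ?addn0 // => y /negbTE ->.
by rewrite andbF.
Qed.

Lemma size_le_deg (T : finType) (e : rel T) y s :
  uniq s -> all (e y) s -> size s <= deg e y.
Proof.
move=> /card_uniqP <- /allP es; rewrite degE; apply: subset_leq_card.
by apply/subsetP => z /es; rewrite inE.
Qed.

Lemma ex_nbr (T : finType) (e : rel T) y (s : seq T) :
  size s < deg e y -> exists2 z, e y z & z \notin s.
Proof.
rewrite degE => lt_s; case: (boolP [exists z, e y z && (z \notin s)]).
  by case/existsP => z /andP[? ?]; exists z.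
move/existsPn => H; have: #|[set z | e y z]| <= #|s|.
  apply: subset_leq_card; apply/subsetP => z; rewrite inE => eyz.
  by have:= H z; rewrite eyz /= negbK.
by have := card_size s; lia.
Qed.

Lemma ex_outside (T : finType) (A : {set T}) (s : seq T) :
  size s < #|A| -> exists2 z, z \in A & z \notin s.
Proof.
move=> lt_s; case: (boolP [exists z, (z \in A) && (z \notin s)]).
  by case/existsP => z /andP[? ?]; exists z.
move/existsPn => H; have: #|A| <= #|s|.
  apply: subset_leq_card; apply/subsetP => z Az.
  by have:= H z; rewrite Az /= negbK.
by have := card_size s; lia.
Qed.

Lemma nbr_mem (T : finType) (e : rel T) y s z :
  uniq s -> all (e y) s -> deg e y <= size s -> e y z -> z \in s.
Proof.
move=> us es ds eyz; apply/negPn/negP => zs.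
by have := @size_le_deg _ e y (z :: s); rewrite /= zs us eyz es => /(_ isT isT) /leq_trans /(_ ds); rewrite ltnn.
Qed.

Lemma edge_deg_gt0 (T : finType) (e : rel T) y z : e y z -> 0 < deg e y.
Proof. by move=> eyz; apply: (@size_le_deg _ e y [:: z]); rewrite //= eyz. Qed.

Lemma add_edge_simple (T : finType) (e : rel T) p q :
  p != q -> simple e -> simple (add_edge e p q).
Proof.
move=> pq [es ei]; split=> [x y|x]; rewrite /add_edge.
  by rewrite es; congr (_ || _); rewrite orbC ![(y == _) && _]andbC.
rewrite ei /= andbC orbb; apply/negP => /andP[/eqP-> /eqP E].
by rewrite E eqxx in pq.
Qed.

Lemma del_edge_simple (T : finType) (e : rel T) p q :
  simple e -> simple (del_edge e p q).
Proof.
move=> [es ei]; split=> [x y|x]; rewrite /del_edge ?ei //.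
by rewrite es [~~ _ && ~~ _]andbC ![(y == _) && _]andbC.
Qed.

Lemma deg_add_edge (T : finType) (e : rel T) p q x :
  p != q -> symmetric e -> ~~ e p q ->
  deg (add_edge e p q) x = deg e x + (x == p) + (x == q).
Proof.
move=> pq es npq; rewrite -(sum_pred1 (x == p) q) -(sum_pred1 (x == q) p).
rewrite -!big_split; apply: eq_bigr => y _; rewrite /= /add_edge.
case: (eqVneq x p) => [->|xp] /=.
  rewrite (negbTE pq) /= addn0 orbF.
  by case: (eqVneq y q) => [->|]; rewrite ?(negbTE npq) ?orbF ?addn0.
case: (eqVneq x q) => [->|xq] /=; rewrite ?orbF ?addn0 //.
by case: (eqVneq y p) => [->|]; rewrite ?(es q) ?(negbTE npq) ?orbF ?addn0.
Qed.

(** The larger degree stands on the left, so that no truncated subtraction occurs. *)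
Lemma deg_del_edge (T : finType) (e : rel T) p q x :
  simple e -> e p q ->
  deg e x = deg (del_edge e p q) x + (x == p) + (x == q).
Proof.
move=> [es ei] epq.
have pq : p != q by apply/eqP => E; rewrite E ei in epq.
rewrite -(sum_pred1 (x == p) q) -(sum_pred1 (x == q) p).
rewrite -!big_split; apply: eq_bigr => y _; rewrite /= /del_edge.
case: (eqVneq x p) => [->|xp] /=.
  rewrite (negbTE pq) /= addn0 andbT.
  by case: (eqVneq y q) => [->|]; rewrite ?epq ?andbT ?addn0.
case: (eqVneq x q) => [->|xq] /=; rewrite ?andbT ?addn0 //.
by case: (eqVneq y p) => [->|]; rewrite ?(es q) ?epq ?andbT ?addn0.
Qed.

Lemma del_vertex_simple (T : finType) (e : rel T) x :
  simple e -> simple (del_vertex e x).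
Proof.
move=> [es ei]; split=> [y z|y]; rewrite /del_vertex ?ei //.
by rewrite es [(y != x) && _]andbC.
Qed.

Lemma deg_del_vertex (T : finType) (e : rel T) x y :
  symmetric e -> y != x -> deg e y = deg (del_vertex e x) y + e x y.
Proof.
move=> es yx; rewrite -(sum_pred1 (e x y) x) -big_split; apply: eq_bigr => z _.
rewrite /= /del_vertex yx /=.
by case: (eqVneq z x) => [->|]; rewrite ?(es y) ?andbT ?andbF ?addn0.
Qed.

Lemma deg_del_vertex_same (T : finType) (e : rel T) x : deg (del_vertex e x) x = 0.
Proof. by rewrite /deg big1 // => z _; rewrite /del_vertex eqxx /= andbF. Qed.

(** Each edge at [x] counts twice in the degree sum, once at [x] and once at its other end. *)
Lemma sum_deg_del_vertex (T : finType) (e : rel T) x :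
  simple e -> \sum_y deg e y = \sum_y deg (del_vertex e x) y + 2 * deg e x.
Proof.
move=> [es ei]; rewrite (bigD1 x) //= [in RHS](bigD1 x) //= deg_del_vertex_same.
rewrite (eq_bigr (fun y => deg (del_vertex e x) y + e x y)); last first.
  by move=> y yx; apply: deg_del_vertex.
have E : deg e x = \sum_(y | y != x) e x y.
  by rewrite /deg (bigD1 x) //= ei.
by rewrite big_split /= -E; lia.
Qed.

Lemma deg0_edge (T : finType) (e : rel T) x y : deg e x = 0 -> e x y = false.
Proof. by move=> d0; apply/negP => /edge_deg_gt0; rewrite d0. Qed.

Lemma add_vertex_simple (T : finType) (e : rel T) x (N : pred T) :
  simple e -> ~~ N x -> simple (add_vertex e x N).
Proof.
move=> [es ei] Nx; split=> [y z|y]; rewrite /add_vertex.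
  by rewrite es; congr (_ || _); rewrite orbC.
by rewrite ei /= orbb; apply/negP => /andP[/eqP-> NX]; rewrite NX in Nx.
Qed.

Lemma deg_add_vertex (T : finType) (e : rel T) x (N : pred T) y :
  symmetric e -> deg e x = 0 -> y != x -> deg (add_vertex e x N) y = deg e y + N y.
Proof.
move=> es d0 yx; rewrite -(sum_pred1 (N y) x) -big_split; apply: eq_bigr => z _.
rewrite /= /add_vertex (negbTE yx) /=.
case: (eqVneq z x) => [->|]; rewrite ?andbT ?andbF ?addn0 ?orbF //.
have -> : e y x = false by rewrite es deg0_edge.
by [].
Qed.

Lemma deg_add_vertex_same (T : finType) (e : rel T) x (N : pred T) :
  deg e x = 0 -> ~~ N x -> deg (add_vertex e x N) x = #|N|.
Proof.
move=> d0 Nx; rewrite /deg -sum1_card [RHS]big_mkcond; apply: eq_bigr => z _.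
rewrite /add_vertex eqxx (@deg0_edge _ e) //= (negbTE Nx) andbF orbF unfold_in.
by case: (N z).
Qed.

(** * Books: copies of K_{3,1,1} with hubs [h1], [h2] and pages [t1], [t2], [t3] *)

(* The edge h1 h2 together with three common neighbours: a copy of K_{3,1,1}. *)
Definition book (T : finType) (e : rel T) (h1 h2 t1 t2 t3 : T) : bool :=
  [&& uniq [:: h1; h2; t1; t2; t3], e h1 h2 &
      all (fun t => e h1 t && e h2 t) [:: t1; t2; t3]].

Definition has_book (T : finType) (e : rel T) : Prop :=
  exists h1 h2 t1 t2 t3, book e h1 h2 t1 t2 t3.

Lemma neqF (T : eqType) (x y : T) : x != y -> ((x == y) = false) * ((y == x) = false).
Proof. by move=> /negbTE xy; split=> //; rewrite eq_sym. Qed.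

Ltac bool_split :=
  repeat match goal with
  | H : is_true (_ \notin [:: _]) |- _ => rewrite inE in H
  | H : is_true (_ \notin _ :: _) |- _ => rewrite inE negb_or in H
  | H : is_true (_ && _) |- _ => case/andP: H => ? ?
  | H : is_true (uniq (_ :: _)) |- _ => rewrite cons_uniq in H
  end.

Ltac neq_simp :=
  bool_split; rewrite /= ?inE;
  repeat match goal with
  | H : is_true (?x != ?y) |- _ => rewrite ?(neqF H); clear H
  end; rewrite ?eqxx ?orbT ?orbF ?andbT ?andbF.

Lemma bookE (T : finType) (e : rel T) h1 h2 t1 t2 t3 :
  uniq [:: h1; h2; t1; t2; t3] -> e h1 h2 -> e h1 t1 -> e h1 t2 -> e h1 t3 ->
  e h2 t1 -> e h2 t2 -> e h2 t3 -> book e h1 h2 t1 t2 t3.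
Proof. by move=> u e0 e1 e2 e3 e4 e5 e6; rewrite /book u e0 /= e1 e2 e3 e4 e5 e6. Qed.

Lemma has_book_sub (T : finType) (e e' : rel T) :
  subrel e e' -> has_book e -> has_book e'.
Proof.
move=> sub [h1 [h2 [t1 [t2 [t3]]]]] /and3P[u /sub E /allP al].
exists h1, h2, t1, t2, t3; rewrite /book u E; apply/allP => t /al /andP[/sub-> /sub->].
by [].
Qed.

(** Every edge of the book contains a hub and has both ends in the book, so an edge that misses both
    hubs or leaves the book can go. *)
Lemma book_del_edge (T : finType) (e : rel T) h1 h2 t1 t2 t3 a b :
  book e h1 h2 t1 t2 t3 ->
  (a \notin [:: h1; h2]) && (b \notin [:: h1; h2])
    || (a \notin [:: h1; h2; t1; t2; t3]) ->
  book (del_edge e a b) h1 h2 t1 t2 t3.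
Proof.
move=> /and3P[u E /allP al] H; apply/and3P; split=> //; rewrite /del_edge ?E.
  by case/orP: H => H; neq_simp.
apply/allP => t tt; have /andP[-> ->] := al t tt.
case/orP: H => H; first by neq_simp.
by move: tt; rewrite !inE => /or3P[] /eqP->; neq_simp.
Qed.

Lemma book_perm12 (T : finType) (e : rel T) h1 h2 t1 t2 t3 :
  book e h1 h2 t1 t2 t3 -> book e h1 h2 t2 t1 t3.
Proof.
case/and3P=> u E /and4P[/andP[? ?] /andP[? ?] /andP[? ?] _].
by apply: bookE => //; neq_simp.
Qed.

Lemma book_perm13 (T : finType) (e : rel T) h1 h2 t1 t2 t3 :
  book e h1 h2 t1 t2 t3 -> book e h1 h2 t3 t2 t1.
Proof.
case/and3P=> u E /and4P[/andP[? ?] /andP[? ?] /andP[? ?] _].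
by apply: bookE => //; neq_simp.
Qed.

Lemma book_hubs_sym (T : finType) (e : rel T) h1 h2 t1 t2 t3 :
  symmetric e -> book e h1 h2 t1 t2 t3 -> book e h2 h1 t1 t2 t3.
Proof.
move=> es /and3P[u E /and4P[/andP[? ?] /andP[? ?] /andP[? ?] _]].
by apply: bookE => //; [neq_simp | rewrite es].
Qed.

(** * Pinching: inserting a vertex of degree 3 *)

(* x is expected to be isolated in e: it subdivides the edge ab and is joined to r. *)
Definition pinch (T : finType) (e : rel T) (x a b r : T) : rel T :=
  add_vertex (del_edge e a b) x (fun z => z \in [:: a; b; r]).

Lemma deg_del_edge_le (T : finType) (e : rel T) a b y :
  deg (del_edge e a b) y <= deg e y.
Proof. by apply: leq_sum => z _; rewrite /del_edge; case: (e y z) => //=; case: (~~ _ && _). Qed.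

(** [a] and [b] lose each other and gain [x], so apart from [x] only [r] changes its degree. *)
Lemma pinch_spec (T : finType) (e : rel T) x a b r :
  simple e -> e a b -> uniq [:: a; b; r] -> x != r -> deg e x = 0 ->
  simple (pinch e x a b r) /\
  forall y, deg (pinch e x a b r) y = if y == x then 3 else deg e y + (y == r).
Proof.
move=> se eab u xr dx.
have xa : x != a by apply/eqP => E; move: eab; rewrite -E deg0_edge.
have xb : x != b by apply/eqP => E; move: eab; rewrite -E se.1 deg0_edge.
have Nx : x \notin [:: a; b; r] by rewrite !inE !negb_or xa xb xr.
have dx' : deg (del_edge e a b) x = 0 by apply/eqP; rewrite -leqn0 -dx deg_del_edge_le.
have se' := del_edge_simple a b se.
split=> [|y]; first exact: add_vertex_simple.
case: eqVneq => [->|yx].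
  rewrite deg_add_vertex_same // -[3]/(size [:: a; b; r]) -(card_uniqP u).
  exact: eq_card.
rewrite deg_add_vertex //; last exact: se'.1.
rewrite (deg_del_edge y se eab) !inE.
move: u; rewrite /= !inE; move=> u; bool_split.
case: (eqVneq y a) => [->|_]; first by neq_simp; lia.
case: (eqVneq y b) => [->|_]; first by neq_simp; lia.
by lia.
Qed.

Lemma pinch_sub (T : finType) (e : rel T) x a b r : subrel (del_edge e a b) (pinch e x a b r).
Proof. by move=> y z H; rewrite /pinch /add_vertex H. Qed.

Lemma deg_le (T : finType) (e : rel T) y (s : seq T) :
  (forall z, e y z -> z \in s) -> deg e y <= size s.
Proof.
move=> H; rewrite leqNgt; apply/negP => /ex_nbr[z /H]; by move=> ->.
Qed.

Lemma simple_neq (T : finType) (e : rel T) y z : irreflexive e -> e y z -> y != z.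
Proof. by move=> ei; apply: contraTneq => ->; rewrite ei. Qed.

(** * An edge avoiding a given vertex whose removal leaves some book *)

(** The vertex to avoid is a hub: a third neighbour of the page [t1] gives an edge that misses both
    hubs. *)
Lemma free_edge_hub (T : finType) (e : rel T) h1 h2 t1 t2 t3 :
  simple e -> book e h1 h2 t1 t2 t3 -> 3 <= deg e t1 ->
  exists a b, [/\ e a b, a != h1, b != h1 & has_book (del_edge e a b)].
Proof.
move=> [es ei] B dt.
have [z tz zh] := @ex_nbr _ e t1 [:: h1; h2] dt.
have /and3P[u _ _] := B.
exists t1, z; split=> //; try by (move: u zh => /= u zh; neq_simp).
exists h1, h2, t1, t2, t3; apply: book_del_edge => //.
by rewrite zh; neq_simp.
Qed.

(** The vertex to avoid is the page [t1]. If [t2] or [t3] is not adjacent to [t1], its third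
    neighbour gives an edge that misses both hubs. *)
Lemma free_edge_page (T : finType) (e : rel T) h1 h2 t1 t2 t3 :
  simple e -> book e h1 h2 t1 t2 t3 -> 3 <= deg e t2 -> 3 <= deg e t3 ->
  exists a b, [/\ e a b, a != t1, b != t1 & has_book (del_edge e a b)].
Proof.
move=> [es ei] B d2 d3.
have [E1 E2 E3 E4] : [/\ e h1 h2, e h1 t1, e h2 t1 & e h2 t2].
  by case/and3P: (B) => _ -> /and4P[/andP[-> ->] /andP[_ ->]].
have [E5 E6] : e h1 t2 /\ e h1 t3.
  by case/and3P: (B) => _ _ /and4P[_ /andP[-> _] /andP[-> _] _].
have /and3P[u _ _] := B.
have step t : t \in [:: t2; t3] -> 3 <= deg e t -> ~~ e t t1 ->
  exists a b, [/\ e a b, a != t1, b != t1 & has_book (del_edge e a b)].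
  move=> tt dt nt; have [z tz zh] := @ex_nbr _ e t [:: h1; h2] dt.
  exists t, z; split=> //.
  - by move: tt; rewrite !inE => /orP[] /eqP->; neq_simp.
  - by apply: contraNneq nt => <-.
  exists h1, h2, t1, t2, t3; apply: book_del_edge => //.
  by rewrite zh; move: tt; rewrite !inE => /orP[] /eqP->; neq_simp.
have [r2|] := boolP (e t2 t1); last by apply: step; rewrite ?inE ?eqxx.
have [r3|] := boolP (e t3 t1); last by apply: step; rewrite ?inE ?eqxx ?orbT.
(* [t1] is now adjacent to [t2] and [t3], so [h1] and [t1] are hubs over [h2], [t2], [t3], and the
   edge between the pages [h2] and [t2] is free. *)
exists h2, t2; split=> //; try by neq_simp.
exists h1, t1, h2, t2, t3; apply: book_del_edge; last by neq_simp.
by apply: bookE; rewrite // 1?es //; neq_simp.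
Qed.

(** A vertex other than [r] outside the book yields an edge leaving the book. Otherwise there are
    only six vertices, and either some page has a fourth neighbour, which yields an edge between
    pages, or the degree sum is too small. *)
Lemma free_edge_nonhub (T : finType) (e : rel T) (A : {set T}) r h1 h2 t1 t2 t3 :
  simple e -> (forall y, y \notin A -> deg e y = 0) -> r \in A ->
  (forall y, y \in A -> y != r -> 3 <= deg e y) ->
  4 * #|A| - 3 <= \sum_y deg e y ->
  book e h1 h2 t1 t2 t3 -> r \notin [:: h1; h2; t1; t2; t3] ->
  ~~ e h1 r -> ~~ e h2 r ->
  exists a b, [/\ e a b, a != r, b != r & has_book (del_edge e a b)].
Proof.
move=> [es ei] sA rA dA sumA B rB n1 n2.
have inA y z : e y z -> y \in A.
  by move=> /edge_deg_gt0; apply: contraTT => /sA->.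
have [E1 E2 E3 E4] : [/\ e h1 h2, e h1 t1, e h2 t1 & e h2 t2].
  by case/and3P: (B) => _ -> /and4P[/andP[-> ->] /andP[_ ->]].
have [E5 E6 E7] : [/\ e h1 t2, e h1 t3 & e h2 t3].
  by case/and3P: (B) => _ _ /and4P[_ /andP[-> _] /andP[-> ->] _].
have /and3P[u _ _] := B.
have [/existsP[w /andP[Aw wB]]|/existsPn noW] :=
  boolP [exists w, (w \in A) && (w \notin [:: r; h1; h2; t1; t2; t3])].
  have wr : w != r by move: wB; rewrite inE negb_or => /andP[].
  have [z wz zr] := @ex_nbr _ e w [:: r] (leq_trans (isT : 1 < 3) (dA w Aw wr)).
  exists w, z; split=> //; first by move: zr; rewrite inE.
  exists h1, h2, t1, t2, t3; apply: book_del_edge => //.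
  by apply/orP; right; move: wB; rewrite inE negb_or => /andP[].
have mem6 y z : e y z -> z \in [:: r; h1; h2; t1; t2; t3].
  by rewrite es => /inA Az; have := noW z; rewrite Az negbK.
have page t : t \in [:: t1; t2; t3] ->
  (exists a b, [/\ e a b, a != r, b != r & has_book (del_edge e a b)]) \/ deg e t <= 3.
  move=> tt; have [|lt3] := leqP (deg e t) 3; [by right | left].
  have [z tz zh] := @ex_nbr _ e t [:: h1; h2; r] lt3.
  exists t, z; split=> //.
  - by move: tt; rewrite !inE => /or3P[] /eqP->; neq_simp.
  - by neq_simp.
  exists h1, h2, t1, t2, t3; apply: book_del_edge => //.
  by move: tt; rewrite !inE => /or3P[] /eqP->; neq_simp.
have [//|d1] := page t1 (mem_head _ _).
have [|//|d2] := page t2; first by rewrite !inE eqxx orbT.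
have [|//|d3] := page t3; first by rewrite !inE eqxx !orbT.
have dr : deg e r <= 3.
  apply: (@deg_le _ e r [:: t1; t2; t3]) => z rz.
  have := mem6 _ _ rz; rewrite !inE.
  case: (eqVneq z r) => [E|_]; first by rewrite E ei in rz.
  case: (eqVneq z h1) => [E|_]; first by rewrite E es (negbTE n1) in rz.
  by case: (eqVneq z h2) => [E|_]; first by rewrite E es (negbTE n2) in rz.
have hub h h' : h \in [:: h1; h2] -> h' \in [:: h1; h2] -> h != h' -> deg e h <= 4.
  move=> hh hh' nh; apply: (@deg_le _ e h [:: h'; t1; t2; t3]) => z hz.
  have := mem6 _ _ hz; rewrite inE.
  have -> /= : z == r = false.
    apply/negP => /eqP E; move: hz hh; rewrite E !inE => hz /orP[] /eqP E'.
      by rewrite E' (negbTE n1) in hz.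
    by rewrite E' (negbTE n2) in hz.
  have zh := simple_neq ei hz; move: hh hh' nh zh; rewrite !inE.
  by case/orP => /eqP-> /orP[] /eqP->; rewrite ?eqxx // => _ zh; neq_simp.
have dh1 : deg e h1 <= 4 by apply: (hub h1 h2); rewrite ?inE ?eqxx ?orbT //; neq_simp.
have dh2 : deg e h2 <= 4 by apply: (hub h2 h1); rewrite ?inE ?eqxx ?orbT //; neq_simp.
have u6 : uniq [:: r; h1; h2; t1; t2; t3] by rewrite cons_uniq rB u.
have subA : {subset A <= [:: r; h1; h2; t1; t2; t3]}.
  by move=> z Az; have := noW z; rewrite Az negbK.
have sE : \sum_y deg e y = \sum_(y <- [:: r; h1; h2; t1; t2; t3]) deg e y.
  rewrite [RHS]big_uniq ?u6 // [RHS]big_mkcond; apply: eq_bigr => y _.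
  by case: ifP => // /negbT yn; apply: sA; apply: contra yn => /subA.
have cA : 6 <= #|A|.
  apply: (@leq_trans #|[:: r; h1; h2; t1; t2; t3]|); first by rewrite (card_uniqP u6).
  apply: subset_leq_card; apply/subsetP; apply/allP.
  rewrite /= rA (inA _ _ E1) !(inA _ h1) //; by rewrite es.
(* The pages and [r] contribute at most 3 each and the hubs at most 4 each: 20 in all, below 4 * 6 -
   3 = 21. *)
move: sumA; rewrite sE !big_cons big_nil.
move: cA d1 d2 d3 dr dh1 dh2; clear; lia.
Qed.

(** [r] can replace [h'] as a hub; the edge from [h'] to [t1] then has an end outside the new
    book. *)
Lemma free_edge_outer_hub (T : finType) (e : rel T) r h h' t1 t2 t3 :
  book e h h' t1 t2 t3 -> r \notin [:: h; h'; t1; t2; t3] ->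
  [&& e r t1, e r t2 & e r t3] -> e h r ->
  exists a b, [/\ e a b, a != r, b != r & has_book (del_edge e a b)].
Proof.
move=> /and3P[u' _ /and4P[/andP[f1 g1] /andP[f2 _] /andP[f3 _] _]] r' /and3P[? ? ?] hr.
exists h', t1; split=> //; [by neq_simp | by neq_simp |].
exists h, r, t1, t2, t3; apply: book_del_edge; last by neq_simp.
by apply: bookE => //; neq_simp.
Qed.

(** A page not adjacent to [r] has a third neighbour, which is not [r], and the edge to it is free.
    If [r] is adjacent to all pages, the cases are whether it is adjacent to a hub. *)
Lemma free_edge_out (T : finType) (e : rel T) (A : {set T}) r h1 h2 t1 t2 t3 :
  simple e -> (forall y, y \notin A -> deg e y = 0) -> r \in A ->
  (forall y, y \in A -> y != r -> 3 <= deg e y) ->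
  4 * #|A| - 3 <= \sum_y deg e y ->
  book e h1 h2 t1 t2 t3 -> r \notin [:: h1; h2; t1; t2; t3] ->
  exists a b, [/\ e a b, a != r, b != r & has_book (del_edge e a b)].
Proof.
move=> [es ei] sA rA dA sumA B rB.
have inA y z : e y z -> y \in A.
  by move=> /edge_deg_gt0; apply: contraTT => /sA->.
have [E1 E2 E3 E4] : [/\ e h1 h2, e h1 t1, e h2 t1 & e h2 t2].
  by case/and3P: (B) => _ -> /and4P[/andP[-> ->] /andP[_ ->]].
have [E5 E6 E7] : [/\ e h1 t2, e h1 t3 & e h2 t3].
  by case/and3P: (B) => _ _ /and4P[_ /andP[-> _] /andP[-> ->] _].
have /and3P[u _ _] := B.
have step t : t \in [:: t1; t2; t3] -> ~~ e r t ->
  exists a b, [/\ e a b, a != r, b != r & has_book (del_edge e a b)].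
  move=> tt nt.
  have tr : t != r by apply: contraTneq tt => ->; neq_simp.
  have tA : t \in A.
    by apply: (inA _ h1); rewrite es; move: tt; rewrite !inE => /or3P[] /eqP->.
  have [z tz zh] := @ex_nbr _ e t [:: h1; h2] (dA t tA tr).
  exists t, z; split=> //; first by apply: contraNneq nt => <-; rewrite es.
  exists h1, h2, t1, t2, t3; apply: book_del_edge => //.
  by rewrite zh; move: tt; rewrite !inE => /or3P[] /eqP->; neq_simp.
have [r1|] := boolP (e r t1); last by apply: step; rewrite ?inE ?eqxx.
have [r2|] := boolP (e r t2); last by apply: step; rewrite ?inE ?eqxx ?orbT.
have [r3|] := boolP (e r t3); last by apply: step; rewrite ?inE ?eqxx ?orbT.
have r123 : [&& e r t1, e r t2 & e r t3] by rewrite r1 r2 r3.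
have [H|n1] := boolP (e h1 r); first exact: (free_edge_outer_hub B).
have [H|n2] := boolP (e h2 r); last exact: (free_edge_nonhub (conj es ei) sA rA dA sumA B).
apply: (free_edge_outer_hub (book_hubs_sym es B)) => //.
by neq_simp.
Qed.

(** Cases by the place of [r]: hub, page or outside the book. The degree bound exempts [r] because
    in [bookable_deg3] it has lost its edge to the deleted vertex and may have degree 2. *)
Lemma free_edge (T : finType) (e : rel T) (A : {set T}) r :
  simple e -> (forall y, y \notin A -> deg e y = 0) -> r \in A ->
  (forall y, y \in A -> y != r -> 3 <= deg e y) ->
  4 * #|A| - 3 <= \sum_y deg e y -> has_book e ->
  exists a b, [/\ e a b, a != r, b != r & has_book (del_edge e a b)].
Proof.
move=> se sA rA dA sumA [h1 [h2 [t1 [t2 [t3 B]]]]].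
have d3 h y : e h y -> y != r -> 3 <= deg e y.
  move=> hy; apply: dA; move: hy; rewrite se.1 => /edge_deg_gt0.
  by apply: contraTT => /sA->.
have /and3P[u E /and4P[/andP[? ?] /andP[? ?] /andP[? ?] _]] := B.
have [r5|] := boolP (r \in [:: h1; h2; t1; t2; t3]); last exact: (free_edge_out se sA rA dA sumA B).
move: r5; rewrite !inE => /or4P[|||/orP[]] /eqP rE; rewrite rE in d3 *.
- by apply: (free_edge_hub se B); apply: (d3 h1) => //; neq_simp.
- by apply: (free_edge_hub se (book_hubs_sym se.1 B)); apply: (d3 h1) => //; neq_simp.
- by apply: (free_edge_page se B); apply: (d3 h1) => //; neq_simp.
- by apply: (free_edge_page se (book_perm12 B)); apply: (d3 h1) => //; neq_simp.
- by apply: (free_edge_page se (book_perm13 B)); apply: (d3 h1) => //; neq_simp.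
Qed.

(** * Realizations of prescribed degrees and edge switches *)

(** [e] only prescribes the degrees: this is the notion of potentially K_{3,1,1}-graphical for a
    degree function in place of a sequence. *)
Definition bookable (T : finType) (e : rel T) : Prop :=
  exists e' : rel T, [/\ simple e', deg e' =1 deg e & has_book e'].

Lemma has_bookI (T : finType) (e : rel T) h1 h2 t1 t2 t3 :
  simple e -> e h1 h2 -> uniq [:: t1; t2; t3] ->
  all (fun t => e h1 t && e h2 t) [:: t1; t2; t3] -> has_book e.
Proof.
move=> [_ ei] E u al; exists h1, h2, t1, t2, t3; rewrite /book E al andbT.
have nE h : (forall t, t \in [:: t1; t2; t3] -> e h t) -> h \notin [:: t1; t2; t3].
  by move=> H; apply/negP => /H; rewrite ei.
have H1 : h1 \notin [:: t1; t2; t3] by apply: nE => t /(allP al)/andP[].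
have H2 : h2 \notin [:: t1; t2; t3] by apply: nE => t /(allP al)/andP[].
by rewrite 2!cons_uniq u H2 in_cons negb_or (simple_neq ei E) H1.
Qed.

Definition switch (T : finType) (e : rel T) (a b c d : T) : rel T :=
  add_edge (add_edge (del_edge (del_edge e a b) c d) a c) b d.

(** Each of the four vertices loses one edge and gains one. *)
Lemma switch_spec (T : finType) (e : rel T) a b c d :
  simple e -> uniq [:: a; b; c; d] -> e a b -> e c d -> ~~ e a c -> ~~ e b d ->
  simple (switch e a b c d) /\ deg (switch e a b c d) =1 deg e.
Proof.
move=> se u eab ecd nac nbd.
have s1 := del_edge_simple a b se; have s2 := del_edge_simple c d s1.
have [ac bd] : a != c /\ b != d by split; neq_simp.
have s3 := add_edge_simple ac s2; have s4 := add_edge_simple bd s3.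
split=> // y; rewrite /switch deg_add_edge //; last first.
- by rewrite /add_edge /del_edge (negbTE nbd) /=; neq_simp.
- exact: s3.1.
rewrite deg_add_edge //; last by rewrite /del_edge (negbTE nac).
- rewrite (deg_del_edge y se eab) (@deg_del_edge _ (del_edge e a b) c d y) //.
    by lia.
  by rewrite /del_edge ecd /=; neq_simp.
exact: s2.1.
Qed.

(** Take a neighbour [z] of [y] outside the K_4. If [z] misses [p] or [q], switching [pq] and [yz]
    destroys [pq] and keeps the edges at [x]; if [z] sees both, then [p] and [q] are hubs over [x],
    [r], [z]. *)
Lemma K4_switch (T : finType) (e : rel T) x p q r y :
  simple e -> uniq [:: x; p; q; r; y] ->
  [&& e x p, e x q, e x r, e p q, e p r & e q r] ->
  ~~ e y x -> ~~ e y p -> ~~ e y q -> 1 < deg e y ->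
  has_book e \/ exists e1 : rel T,
    [/\ simple e1, deg e1 =1 deg e, [&& e1 x p, e1 x q & e1 x r] & ~~ e1 p q].
Proof.
move=> se u K nyx nyp nyq dy; have [es ei] := se.
have [z yz zr] := @ex_nbr _ e y [:: r] dy.
have zx : z != x by apply: contraNneq nyx => <-.
have zp : z != p by apply: contraNneq nyp => <-.
have zq : z != q by apply: contraNneq nyq => <-.
have zy : z != y by apply/eqP => E; rewrite E ei in yz.
bool_split.
have [ezp|nzp] := boolP (e z p); last first.
  right; exists (switch e q p y z).
  have [//|||||s d] := @switch_spec _ e q p y z se => //; try by neq_simp.
  - by rewrite es.
  - by rewrite es.
  - by rewrite es.
  split=> //; rewrite /switch /add_edge /del_edge; last by neq_simp.
  by apply/and3P; split; neq_simp.
have [ezq|nzq] := boolP (e z q); last first.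
  right; exists (switch e p q y z).
  have [//|||||s d] := @switch_spec _ e p q y z se => //; try by neq_simp.
  - by rewrite es.
  - by rewrite es.
  split=> //; rewrite /switch /add_edge /del_edge; last by neq_simp.
  by apply/and3P; split; neq_simp.
left; apply: (@has_bookI _ e p q x r z) => //; first by neq_simp.
by rewrite /= !(es _ x) !(es _ z); apply/and4P; split=> //; apply/andP; split=> //; rewrite es.
Qed.

(** If the three neighbours of [x] are pairwise adjacent, they form a K_4 with [x], and a vertex [y]
    of [A] outside it is not adjacent to [x]. Two neighbours of [y] among the three are hubs over
    [x], the third and [y]; otherwise [y] misses two of them and [K4_switch] applies. *)
Lemma nonadjacent_nbrs (T : finType) (e : rel T) (A : {set T}) x :
  simple e -> 4 < #|A| -> (forall y, y \in A -> 2 < deg e y) -> deg e x = 3 ->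
  has_book e \/ exists (e1 : rel T) p q r,
    [/\ simple e1, deg e1 =1 deg e, uniq [:: x; p; q; r],
        [&& e1 x p, e1 x q & e1 x r] & ~~ e1 p q].
Proof.
move=> se cA dA dx; have [es ei] := se.
have [p xp _] : exists2 z, e x z & z \notin [::] by apply: ex_nbr; rewrite dx.
have [q xq qp] : exists2 z, e x z & z \notin [:: p] by apply: ex_nbr; rewrite dx.
have [r xr rpq] : exists2 z, e x z & z \notin [:: p; q] by apply: ex_nbr; rewrite dx.
have [xp' xq' xr'] : [/\ x != p, x != q & x != r] by split; apply: simple_neq ei _.
have u : uniq [:: x; p; q; r] by neq_simp.
have [pq|pq] := boolP (e p q); last first.
  by right; exists e, p, q, r; split; rewrite ?xp ?xq.
have [pr|pr] := boolP (e p r); last first.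
  by right; exists e, p, r, q; split; rewrite ?xp ?xq //; neq_simp.
have [qr|qr] := boolP (e q r); last first.
  by right; exists e, q, r, p; split; rewrite ?xp ?xq ?xr //; neq_simp.
have [y Ay yK] : exists2 y, y \in A & y \notin [:: x; p; q; r] by apply: ex_outside.
have nyx : ~~ e y x.
  apply/negP => yx; have := @nbr_mem _ e x [:: p; q; r] y.
  rewrite /= xp xq xr dx es; move=> /(_ _ isT isT yx) H.
  by have : y \in [:: p; q; r] by [apply: H; neq_simp]; neq_simp.
have dy := dA y Ay.
have core p' q' r' : uniq [:: x; p'; q'; r'; y] ->
  [&& e x p', e x q', e x r', e p' q', e p' r' & e q' r'] ->
  ~~ e y p' -> ~~ e y q' ->
  has_book e \/ exists (e1 : rel T) p q r,
    [/\ simple e1, deg e1 =1 deg e, uniq [:: x; p; q; r],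
        [&& e1 x p, e1 x q & e1 x r] & ~~ e1 p q].
  move=> u' K np nq; have [|[e1 [s d K1 npq]]] := K4_switch se u' K nyx np nq (ltnW dy).
    by left.
  by right; exists e1, p', q', r'; split=> //; neq_simp.
have K : [&& e x p, e x q, e x r, e p q, e p r & e q r] by rewrite xp xq xr pq pr qr.
have [yp|np] := boolP (e y p).
  have [yq|nq] := boolP (e y q).
    left; apply: (@has_bookI _ e p q x r y) => //; first by neq_simp.
    by rewrite /= (es p x) (es q x) xp xq pr qr !(es _ y) yp yq.
  have [yr|nr] := boolP (e y r).
    left; apply: (@has_bookI _ e p r x q y) => //; first by neq_simp.
    by rewrite /= (es p x) (es r x) xp xr pq (es r q) qr !(es _ y) yp yr.
  apply: (core q r p) => //; first by neq_simp.
  by rewrite (es q p) (es r p) xp xq xr pq pr qr.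
have [yq|nq] := boolP (e y q); last by apply: (core p q r) => //; neq_simp.
have [yr|nr] := boolP (e y r).
  left; apply: (@has_bookI _ e q r x p y) => //; first by neq_simp.
  by rewrite /= (es q x) (es r x) xq xr !(es _ p) pq pr !(es _ y) yq yr.
apply: (core p r q) => //; first by neq_simp.
by rewrite (es r q) xp xq xr pq pr qr.
Qed.

(** * Putting a deleted vertex back *)

(** The neighbourhood of [x] in [e] can be attached to any realization of the remaining degrees. *)
Lemma bookable_del_vertex (T : finType) (e : rel T) x :
  simple e -> bookable (del_vertex e x) -> bookable e.
Proof.
move=> [es ei] [e' [s' d' B']]; exists (add_vertex e' x (e x)).
have dx : deg e' x = 0 by rewrite d' deg_del_vertex_same.
split; first by apply: add_vertex_simple; rewrite ?ei.
  move=> y; case: (eqVneq y x) => [->|yx].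
    rewrite deg_add_vertex_same ?ei // degE cardsE; exact: eq_card.
  by rewrite (deg_add_vertex _ s'.1 dx yx) d' (deg_del_vertex es yx).
by apply: (has_book_sub _ B') => y z H; rewrite /add_vertex H.
Qed.

Lemma sum_add_edge (T : finType) (e : rel T) p q :
  p != q -> simple e -> ~~ e p q ->
  \sum_y deg (add_edge e p q) y = \sum_y deg e y + 2.
Proof.
move=> pq [es ei] npq.
rewrite (eq_bigr (fun y => deg e y + (y == p) + (y == q))); last first.
  by move=> y _; rewrite deg_add_edge.
by rewrite !big_split /= (sum_pred1 true p) (sum_pred1 true q) -addnA.
Qed.

(** The last premise is the induction hypothesis. The sum drops by 4 because deleting [x] costs 6
    and adding [pq] returns 2. *)
Lemma bookable_deg3 (T : finType) (e : rel T) (A : {set T}) x :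
  simple e -> (forall y, y \notin A -> deg e y = 0) -> x \in A -> 5 < #|A| ->
  (forall y, y \in A -> 2 < deg e y) -> deg e x = 3 ->
  4 * #|A| - 3 <= \sum_y deg e y ->
  (forall e' : rel T, simple e' -> (forall y, y \notin A :\ x -> deg e' y = 0) ->
     \sum_y deg e' y = \sum_y deg e y - 4 -> bookable e') ->
  bookable e.
Proof.
move=> se sA Ax cA dA dx sumA IH.
have [|[e1 [p [q [r [s1 d1 u K npq]]]]]] := nonadjacent_nbrs se (ltnW cA) dA dx.
  by move=> B; exists e.
have pq : p != q by neq_simp.
have s1x := del_vertex_simple x s1.
pose e2 := add_edge (del_vertex e1 x) p q.
have s2 : simple e2 by apply: add_edge_simple.
have n2 : ~~ del_vertex e1 x p q by rewrite /del_vertex (negbTE npq).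
(* [p] and [q] exchange [x] for each other, so [r] alone loses an edge. *)
have d2 y : y != x -> deg e y = deg e2 y + (y == r).
  move=> yx; rewrite -d1 deg_add_edge //; last by case: s1x.
  rewrite (@deg_del_vertex _ e1 x y) //; last by case: s1.
  suff -> : (e1 x y : nat) = (y == p) + (y == q) + (y == r) by lia.
  have [xy|nxy] := boolP (e1 x y).
    have : y \in [:: p; q; r].
      apply: (@nbr_mem _ e1 x); rewrite ?d1 ?dx //; first by neq_simp.
      by rewrite /= andbT.
    by rewrite !inE; case/or3P => /eqP->; neq_simp.
  have nt t : e1 x t -> (y == t) = false by move=> xt; apply: contraNF nxy => /eqP->.
  by case/and3P: K => /nt-> /nt-> /nt->.
have d2x : deg e2 x = 0.
  rewrite deg_add_edge ?deg_del_vertex_same //; last by case: s1x.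
  by neq_simp.
have sum2 : \sum_y deg e2 y = \sum_y deg e y - 4.
  rewrite sum_add_edge // -(eq_bigr _ (fun y _ => d1 y)).
  by rewrite (sum_deg_del_vertex x s1) d1 dx; lia.
have sA2 y : y \notin A :\ x -> deg e2 y = 0.
  case: (eqVneq y x) => [-> //|yx]; rewrite !inE yx /= => /sA.
  by rewrite d2 //; lia.
have cAx : #|A :\ x| = #|A|.-1 by rewrite (cardsD1 x A) Ax.
have xr : x != r by neq_simp.
have [e3 [s3 d3 B3]] := IH e2 s2 sA2 sum2.
have [||y|||a [b [ab ar br B]]] := @free_edge _ e3 (A :\ x) r s3.
- by move=> y; rewrite d3; apply: sA2.
- rewrite !inE eq_sym xr /=.
  apply/negPn/negP => /sA; rewrite -d1 => dr; case/and3P: K => _ _.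
  by rewrite s1.1 deg0_edge.
- rewrite !inE => /andP[yx Ay] yr; have := dA y Ay.
  by rewrite d3 d2 // (negbTE yr) addn0.
- rewrite (eq_bigr _ (fun y _ => d3 y)) sum2 cAx; lia.
- exact: B3.
have d3x : deg e3 x = 0 by rewrite d3.
(* Pinching restores exactly the degree 3 of [x] and the unit lost by [r]. *)
have [|||s4 d4] := @pinch_spec _ e3 x a b r s3 ab.
- by rewrite /= !inE negb_or ar br (simple_neq s3.2 ab).
- by [].
- by [].
exists (pinch e3 x a b r); split=> //.
  move=> y; rewrite d4; case: eqVneq => [->|yx]; first by rewrite dx.
  by rewrite d3 -d2.
by exact: (has_book_sub (@pinch_sub _ e3 x a b r) B).
Qed.

(** * The exceptional octahedron *)

(** Among six vertices, degree 4 leaves each vertex exactly one non-neighbour, its antipode. This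
    relation is symmetric, so [p] and [p'] have the same neighbours. *)
Lemma octahedron_antipode (T : finType) (f : rel T) (B : {set T}) p :
  simple f -> (forall y, y \notin B -> deg f y = 0) -> #|B| = 6 ->
  (forall y, y \in B -> deg f y = 4) -> p \in B ->
  exists p', [/\ p' \in B, p' != p, ~~ f p p' &
    forall z, z \in B -> z != p -> z != p' -> f p z && f p' z].
Proof.
move=> [fs fi] sB cB dB Bp.
have anti q : q \in B -> exists q', [/\ q' \in B, q' != q, ~~ f q q' &
    forall z, z \in B -> z != q -> z != q' -> f q z].
  move=> Bq; pose N := [set z | f q z].
  have NB : N \subset B :\ q.
    apply/subsetP => z; rewrite !inE => qz; rewrite eq_sym (simple_neq fi qz) /=.
    by apply/negPn/negP => /sB; rewrite fs in qz; apply/eqP; rewrite -lt0n (edge_deg_gt0 qz).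
  have : #|(B :\ q) :\: N| == 1.
    by rewrite cardsD (setIidPr NB) -degE dB // (cardsD1 q B) Bq in cB *; lia.
  case/cards1P => q' Eq'.
  have : q' \in (B :\ q) :\: N by rewrite Eq' set11.
  rewrite !inE => /and3P[nq q'q Bq']; exists q'; split=> // z Bz zq zq'.
  apply/negPn/negP => nz; have : z \in (B :\ q) :\: N by rewrite !inE nz zq Bz.
  by rewrite Eq' inE (negbTE zq').
have [p' [Bp' p'p np H]] := anti p Bp; exists p'; split=> // z Bz zp zp'.
rewrite H //=; have [s [Bs sp' ns Hs]] := anti p' Bp'.
have ps : p = s.
  apply/eqP/negPn/negP => ps; move: np; rewrite fs Hs //; by rewrite eq_sym.
by apply: Hs => //; rewrite -ps.
Qed.

(** [x] has a neighbour [p], with antipode [p']; the cases are whether [x] misses some [q] other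
    than [p] and [p']. *)
Lemma bookable_octahedron (T : finType) (e : rel T) (A : {set T}) x :
  simple e -> (forall y, y \notin A -> deg e y = 0) -> x \in A -> #|A| = 7 ->
  (forall y, y \in A :\ x -> deg (del_vertex e x) y = 4) -> 0 < deg e x ->
  bookable e.
Proof.
move=> se sA Ax cA dA dx; have [es ei] := se.
set B := A :\ x in dA; have cB : #|B| = 6 by move: cA; rewrite (cardsD1 x A) Ax => -[].
have sf := del_vertex_simple x se.
have sB y : y \notin B -> deg (del_vertex e x) y = 0.
  case: (eqVneq y x) => [->|yx]; first by rewrite deg_del_vertex_same.
  by rewrite !inE yx /= => /sA; rewrite (deg_del_vertex es yx); lia.
have Bx y : y \in B -> y != x by rewrite !inE => /andP[].
have ef y z : y \in B -> z \in B -> del_vertex e x y z = e y z.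
  by move=> /Bx yx /Bx zx; rewrite /del_vertex yx zx !andbT.
have anti p : p \in B -> exists p', [/\ p' \in B, p' != p, ~~ e p p' &
    forall z, z \in B -> z != p -> z != p' -> e p z && e p' z].
  move=> Bp; have [p' [Bp' p'p np H]] := octahedron_antipode sf sB cB dA Bp.
  exists p'; split; rewrite -?ef // => z Bz zp zp'; by rewrite -!ef // H.
have [p xp _] := @ex_nbr _ e x [::] dx.
have Bp : p \in B.
  rewrite !inE eq_sym (simple_neq ei xp) /=; apply/negPn/negP => /sA d0.
  by move: xp; rewrite es deg0_edge.
have [p' [Bp' p'p npp' Hp]] := anti p Bp.
have [px p'x] := (Bx p Bp, Bx p' Bp').
have [/existsP[q /and4P[Bq qp qp' nxq]]|/existsPn full] :=
  boolP [exists q, [&& q \in B, q != p, q != p' & ~~ e x q]].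
- have [q' [Bq' q'q nqq' Hq]] := anti q Bq.
  have /andP[epq ep'q] := Hp q Bq qp qp'.
  have q'p : q' != p by apply: contraNneq nqq' => ->; rewrite es.
  have q'p' : q' != p' by apply: contraNneq nqq' => ->; rewrite es.
  have [r Br rn] : exists2 r, r \in B & r \notin [:: p; p'; q; q'].
    by apply: ex_outside; rewrite cB.
  have [[qx q'x] rx] := (Bx q Bq, Bx q' Bq', Bx r Br).
  have [rp rp' rq rq'] : [/\ r != p, r != p', r != q & r != q'] by split; neq_simp.
  have /andP[epq' _] := Hp q' Bq' q'p q'p'.
  have /andP[epr ep'r] := Hp r Br rp rp'.
  have /andP[eqr eq'r] := Hq r Br rq rq'.
  (* Switching [px], [p'q] to [pp'], [xq] makes [p'] a common neighbour of the hubs [p] and [r],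
     along with [q] and [q']. *)
  have u : uniq [:: p; x; p'; q] by neq_simp.
  have px' : e p x by rewrite es.
  have [s d] := switch_spec se u px' ep'q npp' nxq.
  exists (switch e p x p' q); split=> //.
  apply: (@has_bookI _ _ p r q q' p') => //; first last.
  + rewrite /switch /add_edge /del_edge /= epq epq' !(es r) eqr eq'r ep'r.
    by clear Hp Hq anti; neq_simp.
  + by neq_simp.
  + by rewrite /switch /add_edge /del_edge epr; neq_simp.
(* Now [x] is adjacent to the whole octahedron except perhaps [p']; adjacent [q] and [r] off the
   pair [p], [p'] are hubs over [p], [p'], [x]. *)
have [q Bq qn] : exists2 q, q \in B & q \notin [:: p; p'].
  by apply: ex_outside; rewrite cB.
have [qp qp'] : q != p /\ q != p' by split; neq_simp.
have [q' [Bq' q'q nqq' Hq]] := anti q Bq.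
have [r Br rn] : exists2 r, r \in B & r \notin [:: p; p'; q; q'].
  by apply: ex_outside; rewrite cB.
have [rp rp' rq rq'] : [/\ r != p, r != p', r != q & r != q'] by split; neq_simp.
have xf z : z \in B -> z != p -> z != p' -> e x z.
  by move=> Bz zp zp'; have := full z; rewrite Bz zp zp' negbK.
have /andP[epq ep'q] := Hp q Bq qp qp'.
have /andP[epr ep'r] := Hp r Br rp rp'.
have /andP[eqr _] := Hq r Br rq rq'.
exists e; split=> //; apply: (@has_bookI _ e q r p p' x) => //; first by neq_simp.
by rewrite /= !(es _ p) !(es _ p') !(es _ x) epq ep'q epr ep'r !xf.
Qed.

(** * Five vertices, four-regular graphs and the wheel *)

Lemma sum_mem (T : finType) (A : {set T}) : \sum_y (y \in A : nat) = #|A|.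
Proof.
by rewrite -sum1_card [RHS]big_mkcond; apply: eq_bigr => y _; case: (y \in A).
Qed.

Definition complete_on (T : finType) (A : {set T}) : rel T :=
  fun y z => [&& y \in A, z \in A & y != z].

Lemma complete_on_simple (T : finType) (A : {set T}) : simple (complete_on A).
Proof.
split=> [y z|y]; rewrite /complete_on ?eqxx ?andbF //.
by rewrite eq_sym; case: (y \in A); case: (z \in A).
Qed.

Lemma deg_complete_on (T : finType) (A : {set T}) y :
  deg (complete_on A) y = if y \in A then #|A|.-1 else 0.
Proof.
rewrite degE; case: ifP => Ay; last first.
  by apply: eq_card0 => z; rewrite inE /complete_on Ay.
rewrite (cardsD1 y A) Ay /=; apply: eq_card => z.
by rewrite !inE /complete_on Ay /= andbC eq_sym.
Qed.

(** With at most one vertex of degree 4 the sum would be at most 3 * 5 + 1 = 16. Two vertices of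
    degree 4 are adjacent to everything, hence hubs over the other three. *)
Lemma bookable_five (T : finType) (e : rel T) (A : {set T}) :
  simple e -> (forall y, y \notin A -> deg e y = 0) -> #|A| = 5 ->
  16 < \sum_y deg e y -> has_book e.
Proof.
move=> se sA cA sumA; have [es ei] := se.
have inA y z : e y z -> z \in A.
  by rewrite es => /edge_deg_gt0; apply: contraTT => /sA->.
have le4 y : y \in A -> deg e y <= 4.
  move=> Ay; apply: (@leq_trans #|A :\ y|); last first.
    by move: cA; rewrite (cardsD1 y A) Ay; clear; lia.
  rewrite degE; apply: subset_leq_card; apply/subsetP => z; rewrite !inE => yz.
  by rewrite eq_sym (simple_neq ei yz) (inA y).
pose F := [set y | 3 < deg e y].
have F2 : 1 < #|F|.
  rewrite ltnNge; apply/negP => F1.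
  have : \sum_y deg e y <= \sum_y (3 * (y \in A) + (y \in F)).
    apply: leq_sum => y _; rewrite inE; case: (boolP (y \in A)) => [/le4|/sA->] //.
    by case: ltnP; lia.
  rewrite big_split /= -big_distrr /= !sum_mem cA.
  by move: F1 sumA; clear; lia.
have [h1 Fh1 _] : exists2 y, y \in F & y \notin [::] by apply: ex_outside; apply: leq_trans F2.
have [h2 Fh2 h21] : exists2 y, y \in F & y \notin [:: h1] by apply: ex_outside.
have FA h : h \in F -> h \in A by rewrite inE => dh; apply: contraTT dh => /sA->.
have adj h z : h \in F -> z \in A -> z != h -> e h z.
  move=> Fh Az zh; have Ah := FA h Fh; move: Fh; rewrite inE => dh; apply/negPn/negP => nz; move: dh; rewrite degE ltnNge => /negP; apply.
  apply: (@leq_trans #|(A :\ h) :\ z|).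
    apply: subset_leq_card; apply/subsetP => t; rewrite !inE => ht.
    by rewrite (inA h) // [t == h]eq_sym (simple_neq ei ht) !andbT; apply: contraNneq nz => <-.
  by move: cA; rewrite (cardsD1 h A) Ah (cardsD1 z (A :\ h)) !inE zh Az; clear; lia.
have [t1 A1 n1] : exists2 t, t \in A & t \notin [:: h1; h2] by apply: ex_outside; rewrite cA.
have [t2 A2 n2] : exists2 t, t \in A & t \notin [:: h1; h2; t1] by apply: ex_outside; rewrite cA.
have [t3 A3 n3] : exists2 t, t \in A & t \notin [:: h1; h2; t1; t2].
  by apply: ex_outside; rewrite cA.
apply: (@has_bookI _ e h1 h2 t1 t2 t3) => //.
- by apply: adj => //; [apply: FA | neq_simp].
- by neq_simp.
by rewrite /= !adj //; neq_simp.
Qed.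

Lemma four_regular_seven (T : finType) (A : {set T}) : #|A| = 7 ->
  exists e : rel T, [/\ simple e, forall y, deg e y = 4 * (y \in A) & has_book e].
Proof.
move=> cA; pose s := enum A; have us : uniq s := enum_uniq _.
have ss : size s = 7 by rewrite -cardE.
(* The join of 3K_1 on 0, 1, 2 and the edges 35, 46; its book has hubs 3 and 5. *)
pose E i j := ((i < 3) != (j < 3)) || [&& 2 < i, 2 < j, i != j & odd i == odd j].
pose e : rel T := fun y z => [&& y \in A, z \in A & E (index y s) (index z s)].
have Es i j : E i j = E j i.
  rewrite /E [(j < 3) == _]eq_sym [j == i]eq_sym [odd j == _]eq_sym.
  by case: (2 < i); case: (2 < j).
have se : simple e.
  split=> [y z|y]; rewrite /e; first by rewrite Es; case: (y \in A); case: (z \in A).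
  by rewrite /E !eqxx /= !andbF.
have [x0 _ _] : exists2 x, x \in A & x \notin [::] by apply: ex_outside; rewrite cA.
have nA k : k < 7 -> nth x0 s k \in A by move=> k7; rewrite -mem_enum mem_nth // ss.
exists e; split=> // [y|].
  case: (boolP (y \in A)) => [Ay|nAy]; last first.
    by rewrite /deg big1 // => z _; rewrite /e (negbTE nAy).
  have iy : index y s < 7 by rewrite -ss index_mem mem_enum.
  (* Summing over positions in [s] turns the degree into one of seven closed computations. *)
  transitivity (\sum_(z <- s) E (index y s) (index z s)).
    rewrite /deg big_enum [RHS]big_mkcond; apply: eq_bigr => z _.
    by rewrite /e Ay; case: (z \in A).
  rewrite (big_nth x0) ss big_nat.
  rewrite (eq_bigr (fun k => E (index y s) k : nat)); last first.
    by move=> k /andP[_ k7]; rewrite index_uniq ?ss.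
  rewrite -big_nat; move: iy; case: (index y s) => [|[|[|[|[|[|[|//]]]]]]] _;
    by rewrite unlock.
have en i j : i < 7 -> j < 7 -> e (nth x0 s i) (nth x0 s j) = E i j.
  by move=> i7 j7; rewrite /e !nA // !index_uniq ?ss.
apply: (@has_bookI _ e (nth x0 s 3) (nth x0 s 5) (nth x0 s 0) (nth x0 s 1) (nth x0 s 2)) => //.
- by rewrite en.
- by rewrite /= !inE !nth_uniq ?ss.
by rewrite /= !en.
Qed.

(** The ends of the two removed edges regain their degree from the new vertex [x], which gets degree
    4. *)
Lemma four_regular (T : finType) (A : {set T}) : 6 < #|A| ->
  exists e : rel T, [/\ simple e, forall y, deg e y = 4 * (y \in A) & has_book e].
Proof.
move: {2}#|A| (leqnn #|A|) => n; elim: n A => [|n IH] A; first by lia.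
have [cA _ _|cA leA ltA] := eqVneq #|A| 7; first exact: four_regular_seven.
have [x Ax _] : exists2 x, x \in A & x \notin [::] by apply: ex_outside => /=; lia.
have cAx : #|A| = #|A :\ x|.+1 by rewrite (cardsD1 x A) Ax.
have [||e [se de [h1 [h2 [t1 [t2 [t3 B]]]]]]] := IH (A :\ x); try by lia.
have [es ei] := se.
(* At least seven old vertices leave two outside the book, and removing edges at these two does not
   harm it. *)
have [w1 Aw1 n1] : exists2 w, w \in A :\ x & w \notin [:: h1; h2; t1; t2; t3].
  by apply: ex_outside => /=; lia.
have [w2 Aw2 n2] : exists2 w, w \in A :\ x & w \notin [:: w1; h1; h2; t1; t2; t3].
  by apply: ex_outside => /=; lia.
have [y1 wy1 y1w] : exists2 y, e w1 y & y \notin [:: w2].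
  by apply: ex_nbr; rewrite de Aw1.
have [y2 wy2 y2w] : exists2 y, e w2 y & y \notin [:: w1; y1].
  by apply: ex_nbr; rewrite de Aw2.
have yw1 := simple_neq ei wy1; have yw2 := simple_neq ei wy2.
have dx : deg e x = 0 by rewrite de !inE eqxx.
have xne y z : e y z -> (x != y) && (x != z).
  move=> yz; apply/andP; split; apply/eqP => E; move: yz.
    by rewrite -E deg0_edge.
  by rewrite -E es deg0_edge.
have /andP[xw1 xy1] := xne _ _ wy1; have /andP[xw2 xy2] := xne _ _ wy2.
pose e1 := del_edge e w1 y1; pose e2 := del_edge e1 w2 y2.
have s1 : simple e1 by apply: del_edge_simple.
have s2 : simple e2 by apply: del_edge_simple.
have wy2' : e1 w2 y2 by rewrite /e1 /del_edge wy2 /=; neq_simp.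
have d2 y : deg e y = deg e2 y + (y == w2) + (y == y2) + (y == w1) + (y == y1).
  have E1 : deg e y = deg e1 y + (y == w1) + (y == y1) := deg_del_edge y se wy1.
  have E2 : deg e1 y = deg e2 y + (y == w2) + (y == y2) := deg_del_edge y s1 wy2'.
  by rewrite E1 E2.
have B2 : has_book e2.
  exists h1, h2, t1, t2, t3; apply: book_del_edge.
    by apply: book_del_edge => //; rewrite n1 orbT.
  by move: n2; rewrite inE negb_or => /andP[_ ->]; rewrite orbT.
clearbody e2.
have u : uniq [:: w1; y1; w2; y2] by neq_simp.
have d2x : deg e2 x = 0 by have := d2 x; rewrite dx; clear; lia.
pose N := fun z => z \in [:: w1; y1; w2; y2].
have Nx : ~~ N x by rewrite /N; neq_simp.
have s3 : simple (add_vertex e2 x N) by apply: add_vertex_simple.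
exists (add_vertex e2 x N); split=> // [y|].
  case: (eqVneq y x) => [->|yx].
    rewrite deg_add_vertex_same // Ax.
    apply: (@eq_trans _ _ #|[:: w1; y1; w2; y2]|); first exact: eq_card.
    by rewrite (card_uniqP u).
  rewrite (deg_add_vertex _ s2.1 d2x yx).
  have := de y; rewrite d2 !inE yx /= => <-.
  suff -> : (N y : nat) = (y == w1) + (y == y1) + (y == w2) + (y == y2) by clear; lia.
  rewrite /N !inE.
  case: (eqVneq y w1) => [->|_]; first by neq_simp.
  case: (eqVneq y y1) => [->|_]; first by neq_simp.
  case: (eqVneq y w2) => [->|_]; first by neq_simp.
  by case: (eqVneq y y2).
by apply: (has_book_sub _ B2) => y z yz; rewrite /add_vertex yz.
Qed.

(** Induction from K_4: each new vertex subdivides a rim edge and is joined to the hub [h], which is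
    a pinch. *)
Lemma wheel (T : finType) (A : {set T}) h : h \in A -> 3 < #|A| ->
  exists e : rel T, [/\ simple e, deg e h = #|A|.-1 &
    forall y, y != h -> deg e y = 3 * (y \in A)].
Proof.
move=> Ah; move: {2}#|A| (leqnn #|A|) => n; elim: n A Ah => [|n IH] A Ah; first by lia.
have [cA _ _|cA leA ltA] := eqVneq #|A| 4.
  exists (complete_on A); split; first exact: complete_on_simple.
    by rewrite deg_complete_on Ah.
  by move=> y _; rewrite deg_complete_on cA; case: (y \in A).
have [x Ax xh] : exists2 x, x \in A & x \notin [:: h] by apply: ex_outside => /=; lia.
rewrite inE in xh.
have cAx : #|A| = #|A :\ x|.+1 by rewrite (cardsD1 x A) Ax.
have [|||e [se dh de]] := IH (A :\ x); try by lia.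
  by rewrite !inE eq_sym xh.
have [p Ap ph] : exists2 p, p \in A :\ x & p \notin [:: h] by apply: ex_outside => /=; lia.
rewrite inE in ph.
have [q pq qh] : exists2 q, e p q & q \notin [:: h].
  by apply: ex_nbr; rewrite de // Ap.
have dx : deg e x = 0 by rewrite de // !inE eqxx.
have u : uniq [:: p; q; h].
  by rewrite /= !inE negb_or ph (simple_neq se.2 pq); rewrite inE in qh; rewrite qh.
have [s d] := pinch_spec se pq u xh dx.
exists (pinch e x p q h); split=> //.
  by rewrite d eq_sym (negbTE xh) eqxx dh cAx; lia.
move=> y yh; rewrite d (negbTE yh); case: (eqVneq y x) => [->|yx]; first by rewrite Ax.
by rewrite de // !inE yx addn0.
Qed.

(** * The induction on the number of vertices *)

(* 4 * #|A| - 3 instead of 4 * #|A| - 2 spares a parity argument in the induction.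
   Vertices outside A are isolated, so that deleting a vertex keeps the type T. *)
Lemma bookable_or_octahedral (T : finType) (e : rel T) (A : {set T}) :
  simple e -> (forall y, y \notin A -> deg e y = 0) -> 4 < #|A| ->
  4 * #|A| - 3 <= \sum_y deg e y ->
  bookable e \/ #|A| = 6 /\ forall y, y \in A -> deg e y = 4.
Proof.
move: {2}#|A| (leqnn #|A|) => n; elim: n e A => [|n IH] e A; first by lia.
move=> leA se sA cA sumA; have [es ei] := se.
have [cA5|cA5] := eqVneq #|A| 5.
  left; exists e; split=> //; apply: (bookable_five se sA cA5).
  by rewrite cA5 in sumA.
have [x0 Ax0 _] : exists2 x, x \in A & x \notin [::] by apply: ex_outside => /=; lia.
have [x Ax xmin] : exists2 x, x \in A & forall y, y \in A -> deg e x <= deg e y.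
  by case: (arg_minnP (deg e) Ax0) => x Ax H; exists x.
have cAx : #|A| = #|A :\ x|.+1 by rewrite (cardsD1 x A) Ax.
have sA' y : y \notin A :\ x -> deg (del_vertex e x) y = 0.
  case: (eqVneq y x) => [->|yx]; first by rewrite deg_del_vertex_same.
  by rewrite !inE yx /= => /sA; rewrite (deg_del_vertex es yx); lia.
have sx := sum_deg_del_vertex x se.
have lbound : #|A| * deg e x <= \sum_y deg e y.
  rewrite -sum_mem big_distrl /=; apply: leq_sum => y _.
  by case: (boolP (y \in A)) => [/xmin|_]; rewrite ?mul1n.
(* [4 * #|A| - 7] is the bound 4(k - 1) - 3 for the graph without [x], where k = [#|A|]; its sum is
   lower by [2 * deg e x]. *)
have [del|nodel] := leqP (4 * #|A| - 7 + 2 * deg e x) (\sum_y deg e y).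
  have [|||||B|[c6 d4]] := IH (del_vertex e x) (A :\ x); try by lia.
  - exact: del_vertex_simple.
  - exact: sA'.
  - by left; apply: bookable_del_vertex B.
  left; apply: (@bookable_octahedron _ e A x) => //; first by rewrite cAx c6.
  have : \sum_y deg (del_vertex e x) y = 24.
    rewrite (eq_bigr (fun y => 4 * (y \in A :\ x))).
      by rewrite -big_distrr /= sum_mem c6.
    by move=> y _; case: (boolP (y \in A :\ x)) => [/d4|/sA'].
  (* 24 + 2 [deg e x] is at least 4 * 7 - 3 = 25, so [x] is not isolated. *)
  by move=> s24; rewrite cAx c6 s24 in sumA sx; move: sumA sx; clear; lia.
have [d3|d3] := eqVneq (deg e x) 3.
  left; apply: (@bookable_deg3 _ e A x) => //; first by lia.
    by move=> y /xmin; rewrite d3.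
  move=> e' s' z' sum'.
  have [|||||//|[c6 d4]] := IH e' (A :\ x); try by lia.
  - exact: s'.
  - exact: z'.
  (* The octahedron cannot occur here: it would give [e] the sum 28, while [nodel] bounds it
     strictly by 4 * 7 - 7 + 6 = 27. *)
  have s24 : \sum_y deg e' y = 24.
    rewrite (eq_bigr (fun y => 4 * (y \in A :\ x))).
      by rewrite -big_distrr /= sum_mem c6.
    by move=> y _; case: (boolP (y \in A :\ x)) => [/d4|/z'].
  exfalso; move: nodel; rewrite d3 cAx c6; move: sum'; rewrite s24; clear; lia.
(* For the minimum degree d, 4k - 3 < 4k - 7 + 2d gives d > 2, hence d > 3; and kd < 4k - 7 + 2d,
   that is (k - 2)d <= 4(k - 2), gives d <= 4. *)
have d4 : deg e x = 4 by move: cA5 cA nodel lbound sumA d3; clear; nia.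
(* The sum is now at most 4k, so no degree exceeds the minimum 4. *)
have all4 y : y \in A -> deg e y = 4.
  move=> Ay; apply/eqP; rewrite eqn_leq -{2}d4 xmin // andbT leqNgt; apply/negP => dy.
  have : \sum_z (4 * (z \in A) + (z == y)) <= \sum_z deg e z.
    apply: leq_sum => z _; case: (eqVneq z y) => [->|_]; first by rewrite Ay; lia.
    by case: (boolP (z \in A)) => [/xmin|_]; rewrite ?d4 // addn0.
  rewrite big_split /= -big_distrr /= sum_mem (sum_pred1 true y).
  by move: nodel cA; rewrite d4; clear; lia.
have [c6|c6] := eqVneq #|A| 6; first by right.
left; have [|e' [s' d' B']] := @four_regular _ A; first by lia.
exists e'; split=> // y; rewrite d'; case: (boolP (y \in A)) => [/all4->|/sA->] //.
Qed.

(** * Translation to degree sequences and to [K311] *)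

Lemma realizesE (n : nat) (e : rel 'I_n) (s : seq nat) :
  realizes e s <-> [/\ simple e, size s = n & forall i : 'I_n, deg e i = nth 0 s i].
Proof.
split=> [[es ei ss d]|[[es ei] ss d]]; split=> // i; first by rewrite degE.
by rewrite -degE.
Qed.

Lemma sum_deg_realizes (n : nat) (e : rel 'I_n) (s : seq nat) :
  realizes e s -> \sum_i deg e i = sigma_seq s.
Proof.
move/realizesE => [_ ss d]; rewrite /sigma_seq sumnE (big_nth 0) ss big_mkord.
exact: eq_bigr.
Qed.

Lemma contains_K311P (T : finType) (e : rel T) :
  simple e -> has_book e <-> contains_subgraph K311 e.
Proof.
move=> [es ei]; split=> [[h1 [h2 [t1 [t2 [t3 B]]]]]|[f [fi fe]]].
  have /and3P[u E /and4P[/andP[? ?] /andP[? ?] /andP[? ?] _]] := B.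
  (* [part311] makes 0, 1, 2 the part of size 3, hence the pages; 3 and 4 are the hubs. *)
  pose s := [:: t1; t2; t3; h1; h2].
  have us : uniq s by rewrite /s; neq_simp.
  exists (fun i : 'I_5 => nth h1 s i); split.
    by move=> i j /eqP; rewrite nth_uniq // => /eqP/val_inj.
  move=> [[|[|[|[|[|//]]]]] ?] [[|[|[|[|[|//]]]]] ?] //= _; by rewrite // es.
pose o k : 'I_5 := inord k.
have oE k : k < 5 -> o k = k :> nat by move=> k5; rewrite inordK.
have oe i j : i < 5 -> j < 5 ->
    (if i < 3 then 0 else if i == 3 then 1 else 2) !=
    (if j < 3 then 0 else if j == 3 then 1 else 2) -> e (f (o i)) (f (o j)).
  by move=> i5 j5 H; apply: fe; rewrite /K311 /part311 !oE.
have of_neq i j : i < 5 -> j < 5 -> i != j -> f (o i) != f (o j).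
  by move=> i5 j5; apply: contra => /eqP/fi/(congr1 val) /=; rewrite !oE // => /eqP.
apply: (@has_bookI _ e (f (o 3)) (f (o 4)) (f (o 0)) (f (o 1)) (f (o 2))) => //.
- exact: oe.
- by rewrite /= !inE negb_or !of_neq.
by rewrite /= !oe.
Qed.

Lemma potentially_bookable (n : nat) (e : rel 'I_n) (s : seq nat) :
  realizes e s -> bookable e -> potentially K311 n s.
Proof.
move=> /realizesE[_ ss d] [e' [s' d' B]]; exists e'; split.
  by apply/realizesE; split=> // i; rewrite d' d.
exact/contains_K311P.
Qed.

Lemma potentially_or_octahedral (n : nat) (s : seq nat) :
  4 < n -> graphical n s -> 4 * n - 2 <= sigma_seq s ->
  potentially K311 n s \/ n = 6 /\ s = [:: 4; 4; 4; 4; 4; 4].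
Proof.
move=> n5 [e re] sum_s; have /realizesE[se ss d] := re.
have cT : #|[set: 'I_n]| = n by rewrite cardsT card_ord.
have [|||B|[n6 d4]] := @bookable_or_octahedral _ e [set: 'I_n] se.
- by move=> y; rewrite inE.
- by rewrite cT.
- by rewrite cT (sum_deg_realizes re); move: sum_s; clear; lia.
- by left; apply: potentially_bookable re B.
right; rewrite cT in n6; split=> //.
apply: (@eq_from_nth _ 0) => [|i]; rewrite ss n6 // => i6.
have i_n : i < n by rewrite n6.
rewrite -(d (Ordinal i_n)) d4 ?inE //.
by move: i6; clear; case: i => [|[|[|[|[|[|//]]]]]].
Qed.

(** * Sequences showing that the bounds are sharp *)

Lemma has_book_deg (T : finType) (e : rel T) :
  simple e -> has_book e -> exists h1 h2, [/\ h1 != h2, 3 < deg e h1 & 3 < deg e h2].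
Proof.
move=> [es ei] [h1 [h2 [t1 [t2 [t3 /and3P[u E]]]]]].
case/and4P=> /andP[? ?] /andP[? ?] /andP[? ?] _.
exists h1, h2; split; first by neq_simp.
  apply: (@size_le_deg _ e h1 [:: h2; t1; t2; t3]); first by neq_simp.
  by apply/and5P; split.
apply: (@size_le_deg _ e h2 [:: h1; t1; t2; t3]); first by neq_simp.
by apply/and5P; split=> //; rewrite es.
Qed.

(** The sum is the largest even number below 4n - 2. Only the first entry exceeds 3, while a book
    has two hubs of degree at least 4. *)
Lemma wheel_sequence (n : nat) (s := n.-1 :: nseq n.-1 3) : 4 < n ->
  [/\ graphical n s, sigma_seq s = 4 * n - 4 & ~ potentially K311 n s].
Proof.
case: n @s => [|m] // s m4; rewrite /s /=.
split; last 1 first.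
- move=> [e [/realizesE[se _ d] /contains_K311P - /(_ se) /(has_book_deg se)]].
  case=> h1 [h2 [h12 d1 d2]].
  have h0 h : 3 < deg e h -> h = ord0.
    move=> dh; apply/val_inj => /=; move: dh; rewrite d.
    case: h => [[|k] km] //=; rewrite nth_nseq; by case: ifP.
  by move: h12; rewrite (h0 _ d1) (h0 _ d2) eqxx.
- have cT : #|[set: 'I_m.+1]| = m.+1 by rewrite cardsT card_ord.
  have [||e [se d0 d]] := @wheel _ [set: 'I_m.+1] ord0; rewrite ?inE ?cT //.
    by lia.
  exists e; apply/realizesE; split=> //=; first by rewrite size_nseq.
  move=> i; case: (eqVneq i ord0) => [->|i0]; first by rewrite d0 cT.
  rewrite d // inE; case: i i0 => [[|k] km] //= _.
  by rewrite nth_nseq; rewrite ltnS in km; rewrite km.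
by rewrite /sigma_seq /= sumn_nseq; lia.
Qed.

Lemma octahedron_graphical : graphical 6 [:: 4; 4; 4; 4; 4; 4].
Proof.
(* K_{2,2,2} with antipodal pairs i, 5 - i. *)
exists (fun i j : 'I_6 => (i != j) && (i + j != 5)); apply/realizesE; split=> //.
  split=> [i j|i]; last by rewrite eqxx.
  by rewrite eq_sym addnC.
move=> i; rewrite /deg !big_ord_recl big_ord0.
by case: i => [[|[|[|[|[|[|//]]]]]] ?].
Qed.

(** The hubs of a book spend their degree 4 inside it, so the sixth vertex can only be adjacent to
    the three pages. *)
Lemma octahedron_not_potentially : ~ potentially K311 6 [:: 4; 4; 4; 4; 4; 4].
Proof.
move=> [e [/realizesE[se _ d] /contains_K311P - /(_ se)]].
have d4 i : deg e i = 4 by rewrite d; case: i => [[|[|[|[|[|[|//]]]]]] ?].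
have [es ei] := se.
move=> [h1 [h2 [t1 [t2 [t3 /and3P[u E]]]]]].
case/and4P=> /andP[? ?] /andP[? ?] /andP[? ?] _.
have [w _ wn] : exists2 w, w \in [set: 'I_6] & w \notin [:: h1; h2; t1; t2; t3].
  by apply: ex_outside; rewrite cardsT card_ord.
have n1 : ~~ e h1 w.
  apply/negP => hw; have : w \in [:: h2; t1; t2; t3].
    apply: (@nbr_mem _ e h1); rewrite ?d4 //; first by neq_simp.
    by apply/and5P; split.
  by apply/negP; neq_simp.
have n2 : ~~ e h2 w.
  apply/negP => hw; have : w \in [:: h1; t1; t2; t3].
    apply: (@nbr_mem _ e h2); rewrite ?d4 //; first by neq_simp.
    by apply/and5P; split=> //; rewrite es.
  by apply/negP; neq_simp.
have u6 : uniq [:: w; h1; h2; t1; t2; t3] by rewrite cons_uniq wn u.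
have all6 z : z \in [:: w; h1; h2; t1; t2; t3].
  have [] := @uniq_min_size _ [:: w; h1; h2; t1; t2; t3] (enum 'I_6) u6.
  - by move=> ? _; rewrite mem_enum.
  - by rewrite size_enum_ord.
  by move=> _ ->; rewrite mem_enum.
have : deg e w <= size [:: t1; t2; t3].
  apply: deg_le => z wz; have := all6 z; rewrite !inE.
  have -> : z == w = false by rewrite eq_sym; apply/negbTE/(simple_neq ei wz).
  have -> : z == h1 = false by apply: contraNF n1 => /eqP <-; rewrite es.
  by have -> // : z == h2 = false by apply: contraNF n2 => /eqP <-; rewrite es.
by rewrite d4.
Qed.

(** * The values of sigma(K_{3,1,1}, n) *)

Theorem theorem2 :
  (forall n : nat, (n = 5 \/ 7 <= n) -> is_sigma K311 n (4 * n - 2)) /\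
  [/\ (forall s : seq nat, size s = 6 -> graphical 6 s -> 22 <= sigma_seq s ->
         potentially K311 6 s \/ s = [:: 4; 4; 4; 4; 4; 4]),
      ~ potentially K311 6 [:: 4; 4; 4; 4; 4; 4]
    & is_sigma K311 6 26].
Proof.
split=> [n n57|].
  have n4 : 4 < n by case: n57 => [->|]; lia.
  split.
  - by lia.
  - move=> s _ gs sum_s; have [//|[n6 _]] := potentially_or_octahedral n4 gs sum_s.
    by exfalso; lia.
  (* An even [l'] below 4n - 2 is at most 4n - 4, the sum of the wheel sequence. *)
  move=> l' l'even bl'; rewrite leqNgt; apply/negP => l'lt.
  have [gw sw nw] := wheel_sequence n4; apply/nw/bl' => //.
    by rewrite /= size_nseq; lia.
  by rewrite sw; lia.
have bound s : graphical 6 s -> 22 <= sigma_seq s ->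
    potentially K311 6 s \/ s = [:: 4; 4; 4; 4; 4; 4].
  by move=> gs /(potentially_or_octahedral (isT : 4 < 6) gs) [|[]]; [left | right].
split=> [s _||]; [exact: bound | exact: octahedron_not_potentially | split=> //].
(* The octahedral sequence has sum 24, below 26. *)
- move=> s _ gs sum_s; case: (bound s gs) => // [|E]; first by lia.
  by rewrite E in sum_s.
(* An even [l'] below 26 is at most 24, so the octahedral sequence refutes it. *)
move=> l' l'even bl'; rewrite leqNgt; apply/negP => l'lt.
apply: octahedron_not_potentially; apply: bl' => //; first exact: octahedron_graphical.
by rewrite /sigma_seq /=; lia.
Qed.
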